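(* Let $G$ be a compact group, $n\ge1$, and let $H$ and $N$ be closed subgroups of $G$ such that $N\le H$ and $N$ is normal in $G$. Then $d^{(n)}(H,G)\le d^{(n)}(H/N,G/N)$. Moreover, equality holds if $N\cap[{}_nH,G]$ is trivial.
   Context: For a compact group $X$, $\mu_X$ denotes its normalized Haar measure and $\mu_X^m$ the product measure on $X^m$; $G/N$, $H/N$ are compact groups with their normalized Haar measures. Commutators: $[x,y]=x^{-1}y^{-1}xy$, $[x_1]=x_1$, $[x_1,\dots,x_{k+1}]=[[x_1,\dots,x_k],x_{k+1}]$. For subgroups $A,B$, $[A,B]$ is the subgroup generated by all $[a,b]$, and $[{}_nH,G]=[[\dots[[H,H],H],\dots,H],G]$ with $n$ copies of $H$ (so $[{}_1H,G]=[H,G]$). For a closed subgroup $H$ of a compact group $L$, $d^{(n)}(H,L)=(\mu_H^n\times\mu_L)(\{(h_1,\dots,h_n,g)\in H^n\times L: [h_1,\dots,h_n,g]=1\})$. *)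

(* Defs.v *)
From HB Require Import structures.
From mathcomp Require Import all_boot all_order all_algebra.
From mathcomp Require Import all_classical all_reals all_analysis.
Set Implicit Arguments. Unset Strict Implicit. Unset Printing Implicit Defensive.
Import Order.TTheory GRing.Theory Num.Theory.
Local Open Scope classical_set_scope.
Local Open Scope ereal_scope.

Record compactGroup := CompactGroup {
  cg_carrier :> ptopologicalType;
  cg_mul : cg_carrier -> cg_carrier -> cg_carrier;
  cg_inv : cg_carrier -> cg_carrier;
  cg_one : cg_carrier;
  cg_mulA : forall x y z, cg_mul x (cg_mul y z) = cg_mul (cg_mul x y) z;
  cg_mul1g : forall x, cg_mul cg_one x = x;
  cg_mulg1 : forall x, cg_mul x cg_one = x;
  cg_mulVg : forall x, cg_mul (cg_inv x) x = cg_one;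
  cg_mulgV : forall x, cg_mul x (cg_inv x) = cg_one;
  cg_mul_cont : continuous (fun p : cg_carrier * cg_carrier => cg_mul p.1 p.2);
  cg_inv_cont : continuous cg_inv;
  cg_compact : compact [set: cg_carrier];
  cg_hausdorff : hausdorff_space cg_carrier }.

Arguments cg_mul {_}.
Arguments cg_inv {_}.
Arguments cg_one {_}.

Notation borel T := (g_sigma_algebraType (@open T)).

Section CompactGroupDefs.
Variable G : compactGroup.

Definition comm (x y : G) : G :=
  cg_mul (cg_mul (cg_inv x) (cg_inv y)) (cg_mul x y).

Definition comm_list (s : seq G) : G :=
  if s is x :: s' then foldl comm x s' else cg_one.

Definition is_subgroup (A : set G) : Prop :=
  A cg_one /\ (forall x y, A x -> A y -> A (cg_mul x (cg_inv y))).

(* subgroup generated by a set (abstract, no closure taken) *)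
Definition gen (S : set G) : set G :=
  \bigcap_(K in [set K | is_subgroup K /\ S `<=` K]) K.

Definition commG (A B : set G) : set G :=
  gen [set comm a b | a in A & b in B].

(* [_n H, G] = [[...[[H,H],H],...,H],G] with n copies of H (n >= 1) *)
Definition lower_comm (n : nat) (H K : set G) : set G :=
  commG (iter n.-1 (fun X => commG X H) H) K.

Definition normal_in (N : set G) : Prop :=
  forall g x, N x -> N (cg_mul (cg_inv g) (cg_mul x g)).



Variable R : realType.

(* mu is the (normalized) Haar measure of the closed subgroup H, viewed as a
   Radon probability measure on the Borel sets of G concentrated on H and
   invariant under left translations by elements of H. *)
Definition haar_of (H : set G) (mu : measure (borel G) R) : Prop :=
  [/\ mu (H : set (borel G)) = 1,
      mu [set: borel G] = 1,
      (forall h (A : set (borel G)), H h -> measurable A ->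
          mu [set cg_mul h x | x in A] = mu A),
      (forall A : set (borel G), measurable A ->
          mu A = ereal_inf [set mu U | U in [set U : set (borel G) | open (U : set G) /\ A `<=` U]]) &
      (forall U : set (borel G), open (U : set G) ->
          mu U = ereal_sup [set mu K | K in [set K : set (borel G) | compact (K : set G) /\ K `<=` U]])].

(* d^(n)(H,L) = (mu_H^n x mu_L){(h_1,..,h_n,g) : [h_1,...,h_n,g] = 1},
   computed as the iterated integral (outermost variable h_1). *)
Fixpoint dcomm_aux (H : set G) (muH muL : measure (borel G) R)
    (k : nat) (acc : seq G) : \bar R :=
  match k with
  | 0 => muL [set g : borel G | comm_list (rcons acc g) = cg_one]
  | k'.+1 => \int[muH]_(h in (H : set (borel G))) dcomm_aux H muH muL k' (rcons acc h)
  end.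

Definition dcomm (H : set G) (muH muL : measure (borel G) R) (n : nat) :=
  dcomm_aux H muH muL n [::].

End CompactGroupDefs.

(* Main.v *)
Require Import Defs.
From HB Require Import structures.
From mathcomp Require Import all_boot all_order all_algebra.
From mathcomp Require Import finmap all_classical all_reals all_analysis.
From mathcomp Require Import measurable_realfun.
Import Order.TTheory GRing.Theory Num.Theory.
Set Implicit Arguments. Unset Strict Implicit. Unset Printing Implicit Defensive.
Local Open Scope classical_set_scope.
Local Open Scope ring_scope.
Local Open Scope ereal_scope.

(* If pi : G -> G/N is the projection, the image under pi of the Haar measure of
   a closed subgroup H is the Haar measure of pi(H), by uniqueness of the latter.
   As N <= H is the kernel of pi, the integrals defining d^(n)(H/N, G/N) thus
   become integrals over H and G in which the condition [h_1, ..., h_n, g] = 1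
   is relaxed to [h_1, ..., h_n, g] in N; when N meets [_n H, G] trivially, the
   two conditions coincide.

   Uniqueness: if nu is left invariant and mu right invariant, Fubini applied to
   {(x, y) | x y in C} gives nu(C) <= mu(U) for C closed inside U open, and
   regularity of the measures turns this into an equality.

   Measurability of the inner integrals of d^(n) is not needed: the change of
   variables along pi holds for the lower integral of an arbitrary nonnegative
   function, because pi maps compact sets to compact sets and the Haar measure
   is inner regular. *)

Lemma fubini_sections d1 d2 (T1 : measurableType d1) (T2 : measurableType d2)
    (R : realType) (m1 : {sigma_finite_measure set T1 -> \bar R})
    (m2 : {sigma_finite_measure set T2 -> \bar R}) (E : set (T1 * T2)) :
  measurable E ->
  \int[m1]_x m2 (xsection E x) = \int[m2]_y m1 (ysection E y).
Proof.
move=> mE; have := @product_measure_unique _ _ _ _ _ m1 m2 (m1 \x^ m2)%E.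
by move=> /(_ (@product_measure2E _ _ _ _ _ m1 m2) _ mE).
Qed.

Section BorelSets.
Variable T : ptopologicalType.

Lemma open_borel (U : set T) : open U -> measurable (U : set (borel T)).
Proof. by move=> oU; apply: sub_sigma_algebra. Qed.

Lemma closed_borel (C : set T) : closed C -> measurable (C : set (borel T)).
Proof.
move=> cC; rewrite -[C]setCK; apply: measurableC.
by apply: open_borel; exact: closed_openC.
Qed.

End BorelSets.

Lemma continuous_borel (S T : ptopologicalType) (f : S -> T) :
  continuous f -> measurable_fun [set: borel S] (f : borel S -> borel T).
Proof.
move=> cf; apply: (@measurability _ _ (borel S) (borel T) setT f (@open T)) => //.
move=> _ [U oU <-]; rewrite setTI.
by apply: open_borel; move/continuousP: cf; exact.
Qed.

Section GroupTopology.
Variable G : compactGroup.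
Implicit Types (x y z : G) (C U : set G).

Lemma cg_mulKg x y : cg_mul (cg_inv x) (cg_mul x y) = y.
Proof. by rewrite cg_mulA cg_mulVg cg_mul1g. Qed.

Lemma cg_mulVKg x y : cg_mul x (cg_mul (cg_inv x) y) = y.
Proof. by rewrite cg_mulA cg_mulgV cg_mul1g. Qed.

Lemma cg_mulgK x y : cg_mul (cg_mul x y) (cg_inv y) = x.
Proof. by rewrite -cg_mulA cg_mulgV cg_mulg1. Qed.

Lemma cg_mulgKV x y : cg_mul (cg_mul x (cg_inv y)) y = x.
Proof. by rewrite -cg_mulA cg_mulVg cg_mulg1. Qed.

Lemma cg_invK x : cg_inv (cg_inv x) = x.
Proof. by rewrite -[RHS](cg_mulKg (cg_inv x)) cg_mulVg cg_mulg1. Qed.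

Lemma cg_inv_unique x y : cg_mul x y = cg_one -> y = cg_inv x.
Proof. by move=> xy; rewrite -(cg_mulKg x y) xy cg_mulg1. Qed.

Lemma cg_invM x y : cg_inv (cg_mul x y) = cg_mul (cg_inv y) (cg_inv x).
Proof.
by apply/esym/cg_inv_unique; rewrite -cg_mulA cg_mulVKg cg_mulgV.
Qed.

Lemma cvg_cg_mul (I : Type) (F : set_system I) (FF : Filter F)
    (f g : I -> G) x y :
  f i @[i --> F] --> x -> g i @[i --> F] --> y ->
  cg_mul (f i) (g i) @[i --> F] --> cg_mul x y.
Proof. by move=> fx gy; apply: (cvg_comp2 fx gy); exact: (@cg_mul_cont G (x, y)). Qed.

Lemma cvg_cg_inv (I : Type) (F : set_system I) (FF : Filter F)
    (f : I -> G) x :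
  f i @[i --> F] --> x -> cg_inv (f i) @[i --> F] --> cg_inv x.
Proof. by move=> fx; apply: (cvg_comp _ _ fx); exact: cg_inv_cont. Qed.

Lemma continuous_mull x : continuous (cg_mul x).
Proof. by move=> y; apply: cvg_cg_mul; [exact: cvg_cst|exact: cvg_id]. Qed.

Lemma continuous_comm x : continuous (comm x).
Proof.
move=> y; apply: cvg_cg_mul; apply: cvg_cg_mul; try exact: cvg_cst.
  exact: cg_inv_cont.
exact: cvg_id.
Qed.

Lemma closed_cg_one : closed [set (cg_one : G)].
Proof.
exact/accessible_closed_set1/hausdorff_accessible/cg_hausdorff.
Qed.

Lemma closed_compact C : closed C -> compact C.
Proof. by move=> cC; exact: (subclosed_compact cC (@cg_compact G)). Qed.

Lemma translation_tube C U x : closed C -> open U -> C `<=` U ->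
  exists W : set G, [/\ open W, W x &
    forall x1 x2 y, W x1 -> W x2 -> C (cg_mul x1 y) -> U (cg_mul x2 y)].
Proof.
move=> cC oU CU.
have /compact_near_coveringP nC := closed_compact cC.
pose P (p : G * G) (c : G) := U (cg_mul p.2 (cg_mul (cg_inv p.1) c)).
have /= [|[A B] /= [nA nB] AB] := nC _ (nbhs (x, x)) P _.
  move=> c Cc; rewrite /P.
  have : cg_mul q.2.2 (cg_mul (cg_inv q.2.1) q.1) @[q --> (c, (x, x))] --> c.
    rewrite -[X in _ --> X](cg_mulVKg x); apply: cvg_cg_mul.
      exact: (cvg_comp _ _ cvg_snd cvg_snd).
    apply: cvg_cg_mul; last exact: cvg_fst.
    by apply: cvg_cg_inv; exact: (cvg_comp _ _ cvg_snd cvg_fst).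
  by apply; apply: open_nbhs_nbhs; split=> //; exact: CU.
exists (A `&` B)^°; split.
- exact: open_interior.
- exact: filterI.
- move=> x1 x2 y /interior_subset[Ax _] /interior_subset[_ Bx] Cxy.
  by have := AB (x1, x2) (conj Ax Bx) _ Cxy; rewrite /P /= cg_mulKg.
Qed.

End GroupTopology.

Section InvariantMeasures.
Variables (R : realType) (G : compactGroup) (H : set G).
Implicit Types mu nu : set (borel G) -> \bar R.

Definition left_invariant mu := forall (h : G) (A : set (borel G)),
  H h -> measurable A -> mu [set x | A (cg_mul h x)] = mu A.

Definition right_invariant mu := forall (h : G) (A : set (borel G)),
  H h -> measurable A -> mu [set x | A (cg_mul x h)] = mu A.

Definition inner_regular_open mu := forall (U : set G) (M : \bar R), open U ->
  (forall K : set G, closed K -> K `<=` U -> mu K <= M) -> mu U <= M.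

Definition outer_regular_closed mu := forall (C : set G) (M : \bar R),
  closed C -> (forall U : set G, open U -> C `<=` U -> M <= mu U) -> M <= mu C.

Lemma ae_full (P : probability (borel G) R) (Q : G -> Prop) :
  closed H -> P H = 1 -> (forall x, H x -> Q x) -> \forall x \ae P, Q x.
Proof.
move=> cH PH HQ; exists (~` H); split=> //.
- by apply: measurableC; exact: closed_borel.
- by rewrite probability_setC ?PH ?subee//; exact: closed_borel.
- by move=> x /= nQ /HQ.
Qed.

(* A Borel set of G * G need not be product-measurable, so {(x, y) | x y in C}
   is first enlarged to a finite union of rectangles inside {(x, y) | x y in U}. *)
Lemma invariant_closed_le_open (mu nu : probability (borel G) R) (C U : set G) :
  closed H -> mu H = 1 -> nu H = 1 -> right_invariant mu -> left_invariant nu ->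
  closed C -> open U -> C `<=` U -> nu C <= mu U.
Proof.
move=> cH mu1 nu1 rmu lnu cC oU CU.
have [W hW] := choice (fun x : G => translation_tube x cC oU CU).
have := @cg_compact G; rewrite compact_cover => /(_ G setT W)[||D _ GD].
- by move=> x _; case: (hW x).
- by move=> x _; exists x => //; case: (hW x).
pose B (i : G) := [set y : borel G | exists2 c, C c & W i (cg_mul c (cg_inv y))].
pose E := \bigcup_(i in [set` D]) ((W i : set (borel G)) `*` B i).
have mB i : measurable (B i).
  apply: open_borel.
  rewrite (_ : B i =
      \bigcup_(c in C) ((fun y => cg_mul c (cg_inv y)) @^-1` W i)); last first.
    by apply/seteqP; split=> y [c Cc Wc]; exists c.
  apply: bigcup_open => c _; apply: open_comp; last by case: (hW i).
  move=> y _; apply: cvg_cg_mul; first exact: cvg_cst.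
  exact: cg_inv_cont.
have mE : measurable E.
  apply: fin_bigcup_measurable; first exact: finite_fset.
  move=> i _; apply: measurableX; last exact: mB.
  by apply: open_borel; case: (hW i).
have CE x y : C (cg_mul x y) -> E (x, y).
  move=> Cxy; have [i Di Wx] := GD x I; exists i => //; split=> //=.
  by exists (cg_mul x y) => //; rewrite cg_mulgK.
have EU x y : E (x, y) -> U (cg_mul x y).
  move=> [i Di [/= Wx [c Cc Wc]]]; have [_ _ tube] := hW i.
  by apply: (tube _ _ _ Wc Wx); rewrite cg_mulgKV.
have mC := closed_borel cC; have mU := open_borel oU.
rewrite -[leLHS]mule1 -(probability_setT mu) -integral_cst//.
rewrite -[leRHS]mule1 -(probability_setT nu) -integral_cst//.
apply: (@le_trans _ _ (\int[mu]_x nu (xsection E x))).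
  apply: ae_ge0_le_integral => //.
  - exact: measurable_fun_xsection.
  - apply: (ae_full cH mu1) => x Hx _ /=.
    rewrite -(lnu x)//; apply: le_measure; rewrite ?inE.
    + apply: closed_borel; apply: preimage_closed cC => y _.
      exact: continuous_mull.
    + exact: measurable_xsection.
    + by move=> y /= Cxy; rewrite /xsection /= inE; exact: CE.
rewrite fubini_sections//.
apply: ae_ge0_le_integral => //.
- exact: measurable_fun_ysection.
- apply: (ae_full cH nu1) => y Hy _ /=.
  rewrite -(rmu y U)//; apply: le_measure; rewrite ?inE.
  + exact: measurable_ysection.
  + apply: open_borel; apply: open_comp oU => x _.
    by apply: cvg_cg_mul; [exact: cvg_id|exact: cvg_cst].
  + by move=> x /=; rewrite /ysection /= inE => /EU.
Qed.

Lemma invariant_measure_unique (mu nu : probability (borel G) R) :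
  closed H -> mu H = 1 -> nu H = 1 -> right_invariant mu -> left_invariant nu ->
  outer_regular_closed mu -> inner_regular_open nu ->
  forall A, measurable A -> nu A = mu A.
Proof.
move=> cH mu1 nu1 rmu lnu omu inu.
have le_open (U : set G) : open U -> nu U <= mu U.
  by move=> oU; apply: inu => // K cK KU; exact: invariant_closed_le_open.
have le_closed (C : set G) : closed C -> nu C <= mu C.
  by move=> cC; apply: omu => // U oU CU; exact: invariant_closed_le_open.
apply: (@measure_unique _ R (borel G) (@open G) (fun=> setT)) => //.
- by move=> U V; exact: openI.
- by move=> _; exact: openT.
- exact: bigcup_const.
- move=> U oU; apply/eqP; rewrite eq_le le_open//=.
  have mU := open_borel oU.
  have := le_closed _ (open_closedC oU); rewrite !probability_setC//.
  by rewrite leeD2lE// leeN2.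
- by move=> k /=; rewrite probability_setT ltry.
Qed.

End InvariantMeasures.

Lemma measure_probability d (T : measurableType d) (R : realType)
    (mu : {measure set T -> \bar R}) : mu setT = 1 ->
  exists P : probability T R, forall A, P A = mu A.
Proof.
case: mu => m cm mu1; pose mu := Measure.Pack cm.
pose mixin := @Measure_isProbability.Build _ _ _ (Measure.sort mu) mu1.
by exists (HB.pack_for (probability T R) (Measure.sort mu) mixin).
Qed.

Lemma pushforward_probability d1 d2 (T1 : measurableType d1)
    (T2 : measurableType d2) (R : realType) (mu : {measure set T1 -> \bar R})
    (f : T1 -> T2) : measurable_fun setT f -> mu setT = 1 ->
  exists P : probability T2 R, forall A, P A = mu (f @^-1` A).
Proof.
move=> mf mu1.
pose M : {measure set T2 -> \bar R} :=
  measure_function_pushforward__canonical__measure_function_Measure mu mf.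
have [|P PE] := @measure_probability _ _ _ M; last by exists P.
by rewrite /= /pushforward preimage_setT.
Qed.

Lemma measure_le d (T : measurableType d) (R : realType)
    (mu : {measure set T -> \bar R}) (A B : set T) :
  measurable A -> measurable B -> A `<=` B -> mu A <= mu B.
Proof. by move=> mA mB AB; apply: le_measure; rewrite ?inE. Qed.

Section Haar.
Variables (R : realType) (G : compactGroup) (H : set G).
Variable mu : measure (borel G) R.
Hypothesis haar_mu : haar_of H mu.

Lemma haar_left_invariant : is_subgroup H -> left_invariant H mu.
Proof.
move=> [H1 HV] h A Hh mA; have [_ _ inv _ _] := haar_mu.
rewrite -[RHS](inv (cg_inv h))//; last first.
  by rewrite -[cg_inv h]cg_mul1g; exact: HV.
congr (mu _); apply/seteqP; split=> [x Ax|_ [x Ax <-] /=].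
  by exists (cg_mul h x) => //; rewrite cg_mulKg.
by rewrite cg_mulVKg.
Qed.

Lemma haar_inner_regular : inner_regular_open mu.
Proof.
have [_ _ _ _ inner] := haar_mu => U M oU KM.
rewrite inner//; apply: ge_ereal_sup => _ [K [cK KU] <-]; apply: KM => //.
exact: compact_closed (@cg_hausdorff G) cK.
Qed.

Lemma haar_outer_regular : outer_regular_closed mu.
Proof.
have [_ _ _ outer _] := haar_mu => C M cC UM.
rewrite outer; last exact: closed_borel.
by apply: le_ereal_inf_tmp => _ [U [oU CU] <-]; exact: UM.
Qed.

Lemma haar_inner_approx (A : set (borel G)) (e : R) : measurable A -> (0 < e)%R ->
  exists K : set G, [/\ closed K, K `<=` A & mu (A `\` K) < e%:E].
Proof.
move=> mA e0; have [_ mu1 _ outer _] := haar_mu.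
have mCA : measurable (~` A) by exact: measurableC.
have finite B : measurable B -> mu B < +oo.
  move=> mB; apply: (@le_lt_trans _ _ (mu setT)); last by rewrite mu1 ltry.
  exact: measure_le.
have finCA : mu (~` A) \is a fin_num by rewrite ge0_fin_numE// finite.
have := finCA; rewrite {1}outer// => /(lb_ereal_inf_adherent e0)[_ [U [oU AU] <-]].
rewrite -outer// => ltU; exists (~` U); split.
- exact: open_closedC.
- by apply: subsetCl.
- rewrite setDE setCK setIC -[A]setCK -setDE measureD//.
  + by rewrite (setIidr AU) lteBlDl.
  + exact: open_borel.
  + by apply: finite; exact: open_borel.
Qed.

End Haar.

Section Homomorphisms.
Variables (G Q : compactGroup) (pi : G -> Q).
Hypothesis piM : forall x y, pi (cg_mul x y) = cg_mul (pi x) (pi y).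

Lemma hom_one : pi cg_one = cg_one.
Proof. by rewrite -(cg_mulKg (pi cg_one) (pi cg_one)) -piM cg_mul1g cg_mulVg. Qed.

Lemma hom_inv x : pi (cg_inv x) = cg_inv (pi x).
Proof. by apply: cg_inv_unique; rewrite -piM cg_mulgV hom_one. Qed.

Lemma hom_comm x y : pi (comm x y) = comm (pi x) (pi y).
Proof. by rewrite /comm !piM !hom_inv. Qed.

Lemma hom_comm_list s : pi (comm_list s) = comm_list (map pi s).
Proof.
case: s => [|x s] /=; first exact: hom_one.
by elim: s x => //= y s IH x; rewrite IH hom_comm.
Qed.

End Homomorphisms.

Lemma closed_image (G Q : compactGroup) (pi : G -> Q) (C : set G) :
  continuous pi -> closed C -> closed (pi @` C).
Proof.
move=> cpi cC; apply: (compact_closed (@cg_hausdorff Q)).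
apply: continuous_compact; last exact: closed_compact.
exact: continuous_subspaceT.
Qed.

Section HaarQuotient.
Variables (R : realType) (G Q : compactGroup) (pi : G -> Q) (H : set G).
Variables (mu : measure (borel G) R) (nu : measure (borel Q) R).
Hypotheses (sH : is_subgroup H) (cH : closed H) (cpi : continuous pi).
Hypothesis piM : forall x y, pi (cg_mul x y) = cg_mul (pi x) (pi y).
Hypotheses (hmu : haar_of H mu) (hnu : haar_of (pi @` H) nu).

Let sQ : is_subgroup (pi @` H).
Proof.
have [H1 HV] := sH; split; first by exists cg_one => //; exact: hom_one.
move=> _ _ [x Hx <-] [y Hy <-]; exists (cg_mul x (cg_inv y)); first exact: HV.
by rewrite piM (hom_inv piM).
Qed.

(* Both measures are compared with the reflection of nu, which is right
   invariant. *)
Lemma haar_pushforward (A : set (borel Q)) : measurable A ->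
  nu A = mu (pi @^-1` A).
Proof.
have mpi := continuous_borel cpi.
have [muH muT _ _ _] := hmu; have [nuH nuT _ _ _] := hnu.
have cQ := closed_image cpi cH.
have [P PE] := pushforward_probability mpi muT.
have [S SE] := pushforward_probability (continuous_borel (@cg_inv_cont Q)) nuT.
have [N NE] := measure_probability nuT.
have QV q : (pi @` H) q -> (pi @` H) (cg_inv q).
  by move=> Hq; rewrite -[cg_inv q]cg_mul1g; apply: sQ.2 => //; exact: sQ.1.
have mV (B : set (borel Q)) : measurable B -> measurable (cg_inv @^-1` B : set (borel Q)).
  move=> mB; rewrite -[X in measurable X]setTI.
  exact: (continuous_borel (@cg_inv_cont Q)).
have S1 : S (pi @` H) = 1.
  rewrite SE -nuH; congr (nu _); apply/seteqP; split=> q; last exact: QV.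
  by move=> /QV; rewrite cg_invK.
have rS : right_invariant (pi @` H) S.
  move=> h B Hh mB; rewrite !SE.
  rewrite -[RHS](haar_left_invariant hnu sQ (QV _ Hh)); last exact: mV.
  by congr (nu _); apply/seteqP; split=> q /=; rewrite cg_invM cg_invK.
have oS : outer_regular_closed S.
  move=> C M cC UM; rewrite SE; apply: (haar_outer_regular hnu).
    by apply: preimage_closed cC => q _; exact: cg_inv_cont.
  move=> U oU CU; rewrite (_ : U = cg_inv @^-1` (cg_inv @^-1` U)); last first.
    by apply/seteqP; split=> q /=; rewrite cg_invK.
  rewrite -SE; apply: UM; first by apply: open_comp oU => q _; exact: cg_inv_cont.
  by move=> q Cq /=; apply: CU; rewrite /preimage /= cg_invK.
move=> mA; transitivity (S A).
  rewrite -NE; apply: (@invariant_measure_unique R Q (pi @` H)) => //.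
  - by rewrite NE.
  - by move=> h B Hh mB; rewrite !NE; exact: (haar_left_invariant hnu).
  - move=> U M oU KM; rewrite NE; apply: (haar_inner_regular hnu) => // K cK KU.
    by have := KM K cK KU; rewrite NE.
rewrite -PE; apply/esym; apply: (@invariant_measure_unique R Q (pi @` H)) => //.
- rewrite PE; apply/eqP; rewrite eq_le; apply/andP; split.
    rewrite -muT; apply: measure_le => //.
    by rewrite -[X in measurable X]setTI; apply: mpi => //; exact: closed_borel.
  rewrite -muH; apply: measure_le.
  + exact: closed_borel.
  + by rewrite -[X in measurable X]setTI; apply: mpi => //; exact: closed_borel.
  + by move=> x Hx; exists x.
- move=> _ B [h Hh <-] mB; rewrite !PE -[RHS](haar_left_invariant hmu sH Hh).
    by congr (mu _); apply/seteqP; split=> x /=; rewrite piM.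
  by rewrite -[X in measurable X]setTI; exact: mpi.
- move=> U M oU KM; rewrite PE; apply: (haar_inner_regular hmu).
    by apply: open_comp oU => x _; exact: cpi.
  move=> K cK KU; apply: (le_trans _ (KM (pi @` K) (closed_image cpi cK) _)); last first.
    by move=> _ [x Kx <-]; exact: KU.
  rewrite PE; apply: measure_le.
  + exact: closed_borel.
  + apply: closed_borel; apply: preimage_closed (closed_image cpi cK) => x _.
    exact: cpi.
  + by move=> x Kx; exists x.
Qed.

End HaarQuotient.

(* The library defines the integral of any nonnegative function as a lower
   integral, hence monotonicity needs no measurability. *)
Lemma ge0_le_integral_nonmeas d (T : measurableType d) (R : realType)
    (mu : {measure set T -> \bar R}) (D : set T) (f g : T -> \bar R) :
  (forall x, D x -> 0 <= f x) -> (forall x, D x -> f x <= g x) ->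
  \int[mu]_(x in D) f x <= \int[mu]_(x in D) g x.
Proof.
move=> f0 fg; have g0 x : D x -> 0 <= g x.
  by move=> Dx; rewrite (le_trans (f0 x Dx))// fg.
rewrite !ge0_integralE//; apply: ge_ereal_sup => _ [s sf <-].
apply: ereal_sup_ubound; exists s => // x; apply: (le_trans (sf x)).
by rewrite !patchE; case: ifPn => // /[!inE] Dx; exact: fg.
Qed.

Section LowerIntegralPushforward.
Import HBNNSimple.
Variables (R : realType) (G Q : compactGroup) (pi : G -> Q) (H : set G).
Variables (mu : measure (borel G) R) (nu : measure (borel Q) R).
Hypotheses (cpi : continuous pi) (hmu : haar_of H mu).
Hypothesis nuE : forall A : set (borel Q), measurable A -> nu A = mu (pi @^-1` A).

Let mpi := continuous_borel cpi.

Lemma image_ae_borel (A : set (borel G)) : measurable A ->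
  exists B : set (borel Q), [/\ measurable B, B `<=` pi @` A &
    mu.-negligible (A `\` pi @^-1` B)].
Proof.
move=> mA.
have approx (k : nat) : exists K : set G,
    [/\ closed K, K `<=` A & mu (A `\` K) < (k.+1%:R^-1)%:E].
  exact: (haar_inner_approx hmu).
have [K hK] := choice approx.
have mB : measurable (\bigcup_k (pi @` K k) : set (borel Q)).
  apply: bigcup_measurable => k _; apply: closed_borel.
  by apply: closed_image => //; case: (hK k).
have mD : measurable (A `\` pi @^-1` (\bigcup_k (pi @` K k))).
  by apply: measurableD => //; rewrite -[X in measurable X]setTI; exact: mpi.
exists (\bigcup_k (pi @` K k)); split => //.
  move=> q [k _ [x Kx <-]]; exists x => //.
  by have [_ KA _] := hK k; exact: KA.
exists (A `\` pi @^-1` (\bigcup_k (pi @` K k))); split=> //.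
apply/eqP; rewrite eq_le measure_ge0 andbT; apply/lee_addgt0Pr => e e0.
rewrite add0e; have [k ke] : exists k, (k.+1%:R^-1 < e)%R.
  by have [k _ /(_ _ (leqnn k))] := near_infty_natSinv_lt (PosNum e0); exists k.
have [cK _ ltK] := hK k.
apply: (@le_trans _ _ (mu (A `\` K k))); last first.
  by apply: (le_trans (ltW ltK)); rewrite lee_fin ltW.
apply: measure_le => //; first by apply: measurableD => //; exact: closed_borel.
by move=> x [Ax nB]; split=> // Kx; apply: nB; exists k => //; exists x.
Qed.

Lemma sintegral_pushforward (s : {nnsfun borel Q >-> R}) :
  \int[nu]_q (s q)%:E = \int[mu]_x (s (pi x))%:E.
Proof.
transitivity (\int[pushforward mu (pi : borel G -> borel Q)]_q (s q)%:E).
  by apply: eq_measure_integral => A mA _; exact: nuE.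
rewrite (@ge0_integral_pushforward _ _ (borel G) (borel Q) _ _ mpi)//.
  exact/measurable_EFinP.
by move=> q _; rewrite lee_fin.
Qed.

(* A simple function s <= f o pi is a.e. dominated by s' o pi for a simple
   s' <= f: on Q, s' is the largest value whose level set meets the fiber. *)
Lemma ge0_integral_pushforward_nonmeas (f : Q -> \bar R) :
  (forall q, 0 <= f q) ->
  \int[nu]_(q in [set: borel Q]) f q = \int[mu]_(x in [set: borel G]) f (pi x).
Proof.
move=> f0; apply/eqP; rewrite eq_le; apply/andP; split.
  rewrite ge0_integralTE//; apply: ge_ereal_sup => _ [s sf <-].
  rewrite -integralT_nnsfun sintegral_pushforward.
  by apply: ge0_le_integral_nonmeas => x _; rewrite ?lee_fin.
rewrite [leLHS]ge0_integralTE//; apply: ge_ereal_sup => _ [s sf <-].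
rewrite -integralT_nnsfun.
have /finite_seqP[r rE] := fimfunP s.
have mlevel (c : R) : measurable (s @^-1` [set c] : set (borel G)) by [].
have [B hB] := choice (fun c => image_ae_borel (mlevel c)).
have mB c : measurable (B c) by case: (hB c).
pose t (i : nat) : {nnsfun borel Q >-> R} :=
  mul_nnsfun (cst_nnsfun _ (NngNum (normr_ge0 r`_i))) (indic_nnsfun R (mB r`_i)).
pose s' := bigmax_nnsfun t (size r).
apply: (@le_trans _ _ (\int[mu]_x (s' (pi x))%:E)); last first.
  rewrite -sintegral_pushforward; apply: ge0_le_integral_nonmeas => q _.
    by rewrite lee_fin.
  rewrite bigmax_nnsfunE (big_morph _ (@EFin_max R) erefl).
  apply/bigmax_leP; split=> // i _; rewrite /= mindicE.
  have [|_] := boolP (q \in B r`_i); last by rewrite mulr0.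
  rewrite inE mulr1 => Bq; have [_ sub _] := hB r`_i.
  have [x /= sx <-] := sub _ Bq.
  by rewrite -sx ger0_norm//; exact: sf.
apply: ae_ge0_le_integral => //.
- by move=> x _; rewrite lee_fin.
- exact/measurable_EFinP.
- by move=> x _; rewrite lee_fin.
- by apply/measurable_EFinP; exact: (measurableT_comp (measurable_funPT s') mpi).
- have : mu.-negligible
      (\bigcup_(i : nat) (s @^-1` [set r`_i] `\` pi @^-1` B r`_i)).
    by apply: negligible_bigcup => i; case: (hB r`_i).
  apply: negligibleS => x /= /not_implyP[_ /negP]; rewrite -ltNge lte_fin => lts.
  have : [set` r] (s x) by rewrite -rE; exists x.
  move=> /= /(nthP 0%R)[i ir si]; exists i => //; split=> //= Bx.
  move: lts; rewrite ltNge => /negP; apply.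
  rewrite bigmax_nnsfunE; apply: le_trans (le_bigmax _ _ (Ordinal ir)).
  by rewrite /= mindicE mem_set// mulr1 si ger0_norm.
Qed.

End LowerIntegralPushforward.

Lemma dcomm_aux_ge0 (R : realType) (K : compactGroup) (L : set K)
  (m1 m2 : measure (borel K) R)
  k acc : 0 <= dcomm_aux L m1 m2 k acc.
Proof.
elim: k acc => [|k IH] acc /=; first exact: measure_ge0.
by apply: integral_ge0 => h _; exact: IH.
Qed.

Lemma comm_list_rcons (K : compactGroup) (s : seq K) y :
  comm_list (rcons s y) = if s is [::] then y else comm (comm_list s) y.
Proof. by case: s => //= x s; rewrite foldl_rcons. Qed.

Lemma closed_comm_list_eq1 (K : compactGroup) (s : seq K) :
  closed [set y | comm_list (rcons s y) = cg_one].
Proof.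
rewrite (_ : [set y | _] =
    (fun y => comm_list (rcons s y)) @^-1` [set cg_one]) //.
apply: preimage_closed (@closed_cg_one K) => y _.
rewrite (_ : (fun y => _) = if s is [::] then id else comm (comm_list s)).
  by case: s => [|x s]; [exact: cvg_id|exact: continuous_comm].
by apply/funext => z; rewrite comm_list_rcons; case: s.
Qed.

Lemma sub_gen (K : compactGroup) (S : set K) : S `<=` gen S.
Proof. by move=> x Sx L [_ SL]; exact: SL. Qed.

Section Quotient.
Variables (R : realType) (G Q : compactGroup) (pi : G -> Q) (H : set G).
Variables (muH muG : measure (borel G) R) (muHN muQ : measure (borel Q) R).
Hypotheses (sH : is_subgroup H) (cH : closed H) (cpi : continuous pi).
Hypothesis piM : forall x y, pi (cg_mul x y) = cg_mul (pi x) (pi y).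
Hypothesis pi_surj : forall q, exists g, pi g = q.
Hypothesis ker_pi : forall g, pi g = cg_one -> H g.
Hypotheses (haarH : haar_of H muH) (haarG : haar_of [set: G] muG).
Hypotheses (haarHN : haar_of (pi @` H) muHN) (haarQ : haar_of [set: Q] muQ).

Lemma preimage_image_subgroup : pi @^-1` (pi @` H) = H.
Proof.
apply/seteqP; split=> [x [h Hh pihx]|x Hx]; last by exists x.
have [H1 HV] := sH.
have Hxh : H (cg_mul x (cg_inv h)).
  by apply: ker_pi; rewrite piM (hom_inv piM) pihx cg_mulgV.
have HVh : H (cg_inv h) by rewrite -[cg_inv h]cg_mul1g; exact: HV.
by have := HV _ _ Hxh HVh; rewrite cg_invK cg_mulgKV.
Qed.

Let muQE (A : set (borel Q)) : measurable A -> muQ A = muG (pi @^-1` A).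
Proof.
have imT : pi @` [set: G] = [set: Q].
  by apply/seteqP; split=> // q _; have [g <-] := pi_surj q; exists g.
by apply: (@haar_pushforward R G Q pi [set: G]) => //; rewrite ?imT.
Qed.

Lemma dcomm_aux_quotientS k acc :
  dcomm_aux (pi @` H) muHN muQ k.+1 acc =
  \int[muH]_(h in (H : set (borel G)))
     dcomm_aux (pi @` H) muHN muQ k (rcons acc (pi h)).
Proof.
rewrite /= integral_mkcond.
rewrite (@ge0_integral_pushforward_nonmeas _ _ _ pi H muH)//; last 2 first.
- exact: (haar_pushforward sH cH cpi piM haarH haarHN).
- by move=> q; apply: erestrict_ge0 => q' _; exact: dcomm_aux_ge0.
rewrite [RHS]integral_mkcond; apply: eq_integral => x _.
rewrite !patchE; congr (if _ then _ else _).
rewrite -[in RHS]preimage_image_subgroup; apply/idP/idP; rewrite !inE => h; exact: h.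
Qed.

Lemma dcomm_aux_le k (acc : seq G) :
  dcomm_aux H muH muG k acc <= dcomm_aux (pi @` H) muHN muQ k (map pi acc).
Proof.
elim: k acc => [|k IH] acc.
  rewrite /= muQE; last exact: (closed_borel (@closed_comm_list_eq1 _ _)).
  have cm := @closed_comm_list_eq1 Q (map pi acc).
  apply: measure_le.
  - exact: (closed_borel (@closed_comm_list_eq1 _ _)).
  - by apply: closed_borel; apply: preimage_closed cm => x _; exact: cpi.
  - by move=> x /= eq1; rewrite -map_rcons -(hom_comm_list piM) eq1 (hom_one piM).
rewrite dcomm_aux_quotientS /=; apply: ge0_le_integral_nonmeas => h _.
  exact: dcomm_aux_ge0.
by rewrite -map_rcons; exact: IH.
Qed.

Lemma comm_list_lower_comm (s : seq G) g : (forall x, x \in s -> H x) ->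
  s != [::] -> lower_comm (size s) H [set: G] (comm_list (rcons s g)).
Proof.
move=> Hs s0; rewrite comm_list_rcons; case: s s0 Hs => // x s _ Hs.
apply: sub_gen; exists (comm_list (x :: s)); last by exists g.
elim/last_ind: s Hs => [|s y IH] Hs; first by apply: Hs; rewrite mem_head.
rewrite -rcons_cons comm_list_rcons size_rcons /=; apply: sub_gen.
exists (comm_list (x :: s)).
  by apply: IH => z zs; apply: Hs; rewrite -rcons_cons mem_rcons inE zs orbT.
by exists y => //; apply: Hs; rewrite -rcons_cons mem_rcons mem_head.
Qed.

Lemma dcomm_aux_eq n (acc : seq G) k : (0 < n)%N -> (size acc + k = n)%N ->
  (forall x, x \in acc -> H x) ->
  (forall x, lower_comm n H [set: G] x -> pi x = cg_one -> x = cg_one) ->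
  dcomm_aux H muH muG k acc = dcomm_aux (pi @` H) muHN muQ k (map pi acc).
Proof.
move=> n0 + + trivial; elim: k acc => [|k IH] acc sz Hacc.
  rewrite addn0 in sz.
  rewrite /= muQE; last exact: (closed_borel (@closed_comm_list_eq1 _ _)).
  congr (muG _); apply/seteqP; split=> g /=; rewrite -map_rcons -(hom_comm_list piM).
    by move=> ->; rewrite (hom_one piM).
  move=> pi1; apply: trivial => //; rewrite -sz; apply: comm_list_lower_comm => //.
  by rewrite -size_eq0 sz -lt0n.
rewrite dcomm_aux_quotientS /=; apply: eq_integral => h; rewrite inE => Hh.
rewrite -map_rcons; apply: IH; first by rewrite size_rcons addSnnS.
by move=> x; rewrite mem_rcons inE => /predU1P[->|/Hacc].
Qed.

End Quotient.

(* G/N is represented by a compact group Q together with a continuous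
   surjective homomorphism pi : G -> Q with kernel N (see NOTES.md). *)
Theorem theorem3p5 (R : realType) (G Q : compactGroup) (pi : G -> Q)
    (H N : set G) (n : nat)
    (muH muG : measure (borel G) R) (muHN muQ : measure (borel Q) R) :
  (1 <= n)%N ->
  is_subgroup H -> closed H ->
  is_subgroup N -> closed N -> N `<=` H -> normal_in N ->
  continuous pi ->
  (forall x y : G, pi (cg_mul x y) = cg_mul (pi x) (pi y)) ->
  (forall q : Q, exists g : G, pi g = q) ->
  (forall g : G, pi g = cg_one <-> N g) ->
  haar_of H muH -> haar_of [set: G] muG ->
  haar_of (pi @` H) muHN -> haar_of [set: Q] muQ ->
  dcomm H muH muG n <= dcomm (pi @` H) muHN muQ n /\
  (N `&` lower_comm n H [set: G] = [set cg_one] ->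
     dcomm H muH muG n = dcomm (pi @` H) muHN muQ n).
Proof.
move=> n1 sH cH _ _ NH _ cpi piM pi_surj kerE hH hG hHN hQ.
have ker_pi g : pi g = cg_one -> H g by move=> /kerE; exact: NH.
split.
  exact: (@dcomm_aux_le R G Q pi H muH muG muHN muQ _ _ _ _ _ _ _ _ _ _ n [::]).
move=> trivial.
apply: (@dcomm_aux_eq R G Q pi H muH muG muHN muQ _ _ _ _ _ _ _ _ _ _ n [::]) => //.
move=> x lx /kerE Nx; have : (N `&` lower_comm n H [set: G]) x by [].
by rewrite trivial.
Qed.
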